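(* Let $n\ge 0$ be an integer and let $J\subset\mathbb{R}$ be an interval. For every integer $\lambda\ge 1$ and every triple $(u,v,w)$ of complex-valued functions of class $\mathcal{C}^n$ on $J$ such that $u$ does not vanish on $J$, the following two identities hold on $J$: $$\sum_{p=0}^{n}\binom{n}{p}\frac{(-1)^{p}}{p+\lambda}u^{-p-\lambda}D^{n-p}\left(v\,D^{p}\left(u^{p+\lambda}w\right)\right)=\sum_{p=0}^{n}\binom{n}{p}\frac{(-1)^{p}}{p+\lambda}D^{n-p}\left(v\,D^{p}w\right),$$ $$\sum_{p=0}^{n}\binom{n}{p}\frac{(-1)^{p}}{p+\lambda}u^{p+\lambda}D^{p}\left(v\,D^{n-p}\left(u^{-p-\lambda}w\right)\right)=\sum_{p=0}^{n}\binom{n}{p}\frac{(-1)^{p}}{p+\lambda}D^{p}\left(v\,D^{n-p}w\right).$$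
   Context: $D$ denotes differentiation of complex-valued functions on a real interval and $D^k$ its $k$-th iterate ($D^0$ = identity). All intervals contain at least two distinct points. *)

(* Defs.v *)
From HB Require Import structures.
From mathcomp Require Import all_boot all_order all_algebra.
From mathcomp Require Import complex.
From mathcomp Require Import all_classical all_reals all_analysis.

Set Implicit Arguments.
Unset Strict Implicit.
Unset Printing Implicit Defensive.

Import Order.TTheory GRing.Theory Num.Theory.
Import numFieldNormedType.Exports.

Local Open Scope classical_set_scope.
Local Open Scope complex_scope.
Local Open Scope ring_scope.

(* R[i] has no canonical topology in the libraries; give it the one defined by
   the complex modulus, which every numFieldType carries through its ^o alias. *)
HB.instance Definition _ (R : realType) := NormedModule.copy R[i] R[i]^o.

Section DerivativeOnSet.
Context {R : realType}.
Implicit Types (J : set R) (f : R -> R[i]) (x : R).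

Definition diff_quotient f x : R -> R[i] :=
  fun y => (f y - f x) / (y - x)%:C.

(* The limit is taken along the points y <> x of J, so that it is one-sided at
   an endpoint belonging to J; on J everything below depends only on the
   restriction of f to J. *)
Definition derivable_at_in J f x : Prop :=
  cvg (diff_quotient f x @ within J x^').

Definition derive_in J f : R -> R[i] :=
  fun x => lim (diff_quotient f x @ within J x^').

Definition deriven_in J (k : nat) f : R -> R[i] := iter k (derive_in J) f.

Definition class_C J (n : nat) f : Prop :=
  (forall k, (k < n)%N -> forall x, J x -> derivable_at_in J (deriven_in J k f) x)
  /\ {within J, continuous (deriven_in J n f)}.

End DerivativeOnSet.

(* Main.v *)
Require Import Defs.
From HB Require Import structures.
From mathcomp Require Import all_boot all_order all_algebra.
From mathcomp Require Import complex.
From mathcomp Require Import all_classical all_reals all_analysis.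
From mathcomp Require Import ring lra zify.

Set Implicit Arguments.
Unset Strict Implicit.
Unset Printing Implicit Defensive.

Import Order.TTheory GRing.Theory Num.Theory.
Import numFieldNormedType.Exports.

Local Open Scope classical_set_scope.
Local Open Scope complex_scope.
Local Open Scope ring_scope.

(** Each side of the two identities has the form
[sum_p C(n,p) c_p D^(n-p) (v D^p G_p)], or the same with [p] and [n-p] exchanged
as differentiation orders.  The Leibniz rule turns such a sum into a combination
of the values [D^j v x], so the two sides agree as soon as the coefficients of
each [D^j v x] do ([sum_leibniz_outer], [sum_leibniz_inner]).  Because
[C(n,p) C(n-p,j) = C(n,j) C(n-j,p)], the coefficient of [D^j v x] is, with
[m = n - j],
[C(n,j) sum_p C(m,p) c_p (D^m G_p) x], and what remains to be seen is that
[sum_p C(m,p) (-1)^p/(p+l) g(x)^-(p+l) D^m (g^(p+l) w) x] does not change when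
[g] is replaced by the constant [1] ([sum_deriven_scaled_power]).

For this last point, divide [g] by [g x] to get a function [h] with [h x = 1].
The sum is then [D^m (B(h) w) x] for the polynomial
[B = sum_p C(m,p) (-1)^p/(p+l) X^(p+l)], whose derivative is
[X^(l-1) (1-X)^m].  Hence [(B(h))' = h' h^(l-1) (1-h)^m] has a zero of order [m]
at [x], so the derivatives of [B(h)] of orders [1] to [m] vanish at [x]
([deriven_horner_flat]), and the Leibniz rule leaves [B(1) D^m w x], a value in
which [g] no longer occurs.

The first identity takes [g = u]; the second takes [g = 1/u] and [l + j] in
place of [l], the shift by [j] coming from the reindexing in
[sum_leibniz_inner]. *)

(** * A binomial product *)

Lemma mul_bin_swap n p j : (p + j <= n)%N ->
  ('C(n, p) * 'C(n - p, j) = 'C(n, j) * 'C(n - j, p))%N.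
Proof.
have multinomial q k : (q + k <= n)%N ->
    ('C(n, q) * 'C(n - q, k) * (q`! * k`! * (n - q - k)`!) = n`!)%N.
  move=> qk; rewrite -(@bin_fact n q); last by lia.
  by rewrite -(@bin_fact (n - q) k); [ring|lia].
move=> pj; apply/eqP.
rewrite -(@eqn_pmul2r (p`! * j`! * (n - p - j)`!)) ?muln_gt0 ?fact_gt0//.
rewrite multinomial// subnAC (mulnC p`!) multinomial//; lia.
Qed.

(* keeps iterated derivatives in the form in which the rules below match them *)
Arguments deriven_in : simpl never.

(** * First derivatives along an interval *)

Section DerivativeCalculus.
Context {R : realType} (J : set R).
Context (J_itv : is_interval J).
Context (J_nontriv : exists a b : R, [/\ J a, J b & a != b]).
Implicit Types (f g h : R -> R[i]) (x y : R) (n m k : nat).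

(** Makes limits along the points of [J] other than [x] unique: the points of the
segment from [x] to another point of [J] lie in [J] and accumulate at [x]. *)
Lemma within_punctured_proper x : J x -> ProperFilter (within J x^').
Proof.
move=> Jx; have [a [b [Ja Jb ab]]] := J_nontriv.
have [y Jy yx] : exists2 y, J y & y != x.
  have [ax|ax] := eqVneq a x; last by exists a.
  by exists b => //; rewrite -ax eq_sym.
apply: Build_ProperFilter_ex => B.
rewrite /within /= /dnbhs /within /= => /nbhs_ballP[e /= e0 He].
have yx0 : 0 < `|y - x| by rewrite normr_gt0 subr_eq0.
(* the fraction of the way from [x] to [y] at which one is within [e] of [x] *)
pose t := Num.min 1 (e / 2 / `|y - x|).
have t0 : 0 < t by rewrite lt_min ltr01 !divr_gt0.
have t1 : t <= 1 by rewrite ge_min lexx.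
exists (x + t * (y - x)); apply: He.
- rewrite /ball /= opprD addNKr normrN normrM (gtr0_norm t0).
  apply: (@le_lt_trans _ _ (e / 2)); last by rewrite ltr_pdivrMr// ltr_pMr// ltr1n.
  by rewrite -ler_pdivlMr// ge_min lexx orbT.
- by rewrite -subr_eq0 addrAC subrr add0r mulf_neq0 ?subr_eq0 ?(gt_eqF t0).
- have [xy|xy|xy] := ltgtP x y; last by rewrite xy eqxx in yx.
  + apply: (J_itv Jx Jy); apply/andP; split; nra.
  + apply: (J_itv Jy Jx); apply/andP; split; nra.
Qed.

Definition has_derivative f x (d : R[i]) : Prop :=
  diff_quotient f x @ within J x^' --> d.

Lemma derivable_has_derivative f x :
  derivable_at_in J f x -> has_derivative f x (derive_in J f x).
Proof. by []. Qed.

Lemma has_derivative_derivable f x d :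
  has_derivative f x d -> derivable_at_in J f x.
Proof. by move=> fd; apply/cvg_ex; exists d. Qed.

Lemma derive_in_eq f x d : J x -> has_derivative f x d -> derive_in J f x = d.
Proof.
move=> Jx fd; have P := within_punctured_proper Jx.
by apply: cvg_lim fd; exact: norm_hausdorff.
Qed.

Lemma cvg_within_eq f g x (d : R[i]) : (forall y, J y -> y != x -> f y = g y) ->
  f @ within J x^' --> d -> g @ within J x^' --> d.
Proof.
move=> fg; apply: cvg_trans; apply: near_eq_cvg.
rewrite near_withinE; near=> y => Jy.
by rewrite fg//; near: y; exact: nbhs_dnbhs_neq.
Unshelve. all: by end_near. Qed.

Lemma has_derivative_eq f g x d : (forall y, J y -> f y = g y) -> J x ->
  has_derivative f x d -> has_derivative g x d.
Proof.
move=> fg Jx; apply: cvg_within_eq => y Jy _.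
by rewrite /diff_quotient !fg.
Qed.

(** The difference quotients agree along the filter, so the two limits are the
same term even where they do not exist. *)
Lemma derive_in_ext f g x : (forall y, J y -> f y = g y) -> J x ->
  derive_in J f x = derive_in J g x.
Proof.
move=> fg Jx; rewrite /derive_in; congr (lim _).
have fg' y : J y -> diff_quotient f x y = diff_quotient g x y.
  by move=> Jy; rewrite /diff_quotient !fg.
by apply/seteqP; split=> A HA; rewrite nbhs_filterE /fmap /=;
  move: HA; rewrite nbhs_filterE /fmap /= => HA;
  apply: (@filterS _ (x^') _ _ _ _ HA) => y /= Hy Jy; have := Hy Jy; rewrite fg'.
Qed.

Lemma subC_neq0 x y : y != x -> (y - x)%:C != 0.
Proof. by move=> yx; rewrite eq_complex /= eqxx andbT subr_eq0. Qed.

Lemma cvg_subC x : (fun y : R => (y - x)%:C) @ within J x^' --> (0 : R[i]).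
Proof.
apply/cvgr0Pnorm_lt => -[er ei].
rewrite ltcE /= => /andP[/eqP -> er0].
rewrite near_withinE; near=> y => _.
rewrite normc_def /= expr0n addr0 sqrtr_sqr ltcR distrC.
by near: y; apply: nbhs_dnbhs; exact: nbhsx_ballx.
Unshelve. all: by end_near. Qed.

Lemma has_derivative_continuous f x d : has_derivative f x d ->
  f @ within J x^' --> f x.
Proof.
move=> fd.
rewrite -[f x]addr0 -(mulr0 d).
apply: (@cvg_within_eq (fun y => f x + diff_quotient f x y * (y - x)%:C)).
  by move=> y _ yx; rewrite /diff_quotient divfK ?subC_neq0// addrC subrK.
apply: cvgD; first exact: cvg_cst.
exact: (cvgM fd (@cvg_subC x)).
Qed.

Lemma has_derivative_cst (c : R[i]) x : has_derivative (fun=> c) x 0.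
Proof.
apply: (@cvg_within_eq (fun=> 0)); last exact: cvg_cst.
by move=> y _ _; rewrite /diff_quotient subrr mul0r.
Qed.

Lemma has_derivativeD f g x df dg : has_derivative f x df ->
  has_derivative g x dg -> has_derivative (fun y => f y + g y) x (df + dg).
Proof.
move=> fd gd.
apply: (@cvg_within_eq (fun y => diff_quotient f x y + diff_quotient g x y)).
  by move=> y _ _; rewrite /diff_quotient -mulrDl addrACA opprD.
exact: (cvgD fd gd).
Qed.

Lemma has_derivativeM f g x df dg : has_derivative f x df ->
  has_derivative g x dg ->
  has_derivative (fun y => f y * g y) x (df * g x + f x * dg).
Proof.
move=> fd gd.
apply: (@cvg_within_eq
  (fun y => diff_quotient f x y * g y + f x * diff_quotient g x y)).
  by move=> y _ _; rewrite /diff_quotient; ring.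
apply: cvgD; first exact: (cvgM fd (has_derivative_continuous gd)).
exact: (cvgM (cvg_cst _) gd).
Qed.

Lemma has_derivativeV f x df : (forall y, J y -> f y != 0) -> J x ->
  has_derivative f x df ->
  has_derivative (fun y => (f y)^-1) x (- df * ((f x)^-1 * (f x)^-1)).
Proof.
move=> f0 Jx fd.
apply: (@cvg_within_eq
  (fun y => - diff_quotient f x y * ((f y)^-1 * (f x)^-1))).
  move=> y Jy yx; rewrite /diff_quotient.
  by rewrite mulNr mulrAC -mulNr; congr (_ * _); field; rewrite !f0.
have fVx : (fun y => (f y)^-1) @ within J x^' --> (f x)^-1.
  exact: (cvgV (f0 _ Jx) (has_derivative_continuous fd)).
by apply: (cvgM (cvgN fd)); apply: (cvgM fVx); exact: cvg_cst.
Qed.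

(** Powers, and the polynomial in [f] on which the proof turns, are all handled
as values [P.[f y]]: an induction on [P] needs only sums and products. *)
Lemma has_derivative_horner (P : {poly R[i]}) f x df : has_derivative f x df ->
  has_derivative (fun y => P.[f y]) x (P^`().[f x] * df).
Proof.
move=> fd; elim/poly_ind: P => [|P c IH].
  rewrite deriv0 horner0 mul0r.
  by under eq_fun do rewrite horner0; exact: has_derivative_cst.
under eq_fun do rewrite hornerMXaddC.
have -> : (P * 'X + c%:P)^`().[f x] * df = P^`().[f x] * df * f x + P.[f x] * df + 0.
  by rewrite derivMXaddC hornerD hornerMX; ring.
apply: has_derivativeD; last exact: has_derivative_cst.
exact: has_derivativeM.
Qed.

(** * Higher derivatives and the Leibniz rule *)

(** The differentiability part of [class_C].  Being void at order [0] and
weakening with the order, it is what inductions on the order preserve. *)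
Definition ndiff n f : Prop :=
  forall k, (k < n)%N -> forall x, J x -> derivable_at_in J (deriven_in J k f) x.

Lemma derivenS n f : deriven_in J n.+1 f = deriven_in J n (derive_in J f).
Proof. exact: iterSr. Qed.

Lemma deriven_ext n f g : (forall y, J y -> f y = g y) ->
  forall x, J x -> deriven_in J n f x = deriven_in J n g x.
Proof.
move=> fg; elim: n => [//|n IH] x Jx /=.
exact: derive_in_ext.
Qed.

Lemma ndiff_ext n f g : (forall y, J y -> f y = g y) -> ndiff n f -> ndiff n g.
Proof.
move=> fg fn k kn x Jx; apply: has_derivative_derivable.
apply: (has_derivative_eq (deriven_ext k fg)) => //.
exact: derivable_has_derivative (fn _ kn _ Jx).
Qed.

Lemma ndiffS n f : ndiff n.+1 f <->
  (forall x, J x -> derivable_at_in J f x) /\ ndiff n (derive_in J f).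
Proof.
split=> [fn|[f1 fn] [|k] kn x Jx]; last 2 first.
- exact: f1.
- by rewrite derivenS; exact: fn.
split=> [|k kn]; first exact: (fn 0).
by rewrite -derivenS; exact: fn.
Qed.

Lemma ndiff_le n m f : (m <= n)%N -> ndiff n f -> ndiff m f.
Proof. by move=> mn fn k km; apply: fn; exact: leq_trans km mn. Qed.

Lemma ndiff_deriven n k f : (k <= n)%N -> ndiff n f ->
  ndiff (n - k) (deriven_in J k f).
Proof.
move=> kn fn i ink; rewrite /deriven_in -iterD.
by apply: fn; rewrite -ltn_subRL -?subSn // in ink *; lia.
Qed.

Lemma ndiff_cst n (c : R[i]) : ndiff n (fun=> c).
Proof.
elim: n c => [|n IH] c; first by move=> [].
apply/ndiffS; split=> [x Jx|].
  exact: has_derivative_derivable (has_derivative_cst _ _).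
apply: ndiff_ext (IH 0) => y Jy.
by rewrite (derive_in_eq Jy (has_derivative_cst c y)).
Qed.

Lemma derive_inD f g x : J x -> derivable_at_in J f x ->
  derivable_at_in J g x ->
  derive_in J (fun y => f y + g y) x = derive_in J f x + derive_in J g x.
Proof.
move=> Jx /derivable_has_derivative fx /derivable_has_derivative gx.
exact: (derive_in_eq Jx (has_derivativeD fx gx)).
Qed.

Lemma derive_inM f g x : J x -> derivable_at_in J f x ->
  derivable_at_in J g x ->
  derive_in J (fun y => f y * g y) x =
  derive_in J f x * g x + f x * derive_in J g x.
Proof.
move=> Jx /derivable_has_derivative fx /derivable_has_derivative gx.
exact: (derive_in_eq Jx (has_derivativeM fx gx)).
Qed.

Lemma ndiffD n f g : ndiff n f -> ndiff n g -> ndiff n (fun y => f y + g y).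
Proof.
elim: n f g => [|n IH] f g; first by move=> _ _ [].
move=> /ndiffS[f1 fn] /ndiffS[g1 gn]; apply/ndiffS; split=> [x Jx|].
  have [fx gx] := (f1 _ Jx, g1 _ Jx).
  exact: has_derivative_derivable (has_derivativeD fx gx).
by apply: ndiff_ext (IH _ _ fn gn) => y Jy; rewrite derive_inD//; [exact: f1|exact: g1].
Qed.

Lemma ndiffM n f g : ndiff n f -> ndiff n g -> ndiff n (fun y => f y * g y).
Proof.
elim: n f g => [|n IH] f g; first by move=> _ _ [].
move=> fn1 gn1; have [/ndiffS[f1 fn] /ndiffS[g1 gn]] := (fn1, gn1).
apply/ndiffS; split=> [x Jx|].
  have [fx gx] := (f1 _ Jx, g1 _ Jx).
  exact: has_derivative_derivable (has_derivativeM fx gx).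
have fgn : ndiff n (fun y => derive_in J f y * g y + f y * derive_in J g y).
  have fn' := ndiff_le (leqnSn n) fn1; have gn' := ndiff_le (leqnSn n) gn1.
  exact: (ndiffD (IH _ _ fn gn') (IH _ _ fn' gn)).
by apply: ndiff_ext fgn => y Jy; rewrite derive_inM//; [exact: f1|exact: g1].
Qed.

Lemma ndiffV n f : (forall y, J y -> f y != 0) -> ndiff n f ->
  ndiff n (fun y => (f y)^-1).
Proof.
move=> f0; elim: n => [|n IH]; first by move=> _ [].
move=> fn1; have /ndiffS[f1 fn] := fn1.
have {}IH := IH (ndiff_le (leqnSn n) fn1).
have fV y (Jy : J y) := has_derivativeV f0 Jy (derivable_has_derivative (f1 y Jy)).
apply/ndiffS; split=> [x Jx|]; first exact: has_derivative_derivable (fV _ Jx).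
have gn : ndiff n (fun y => -1 * derive_in J f y * ((f y)^-1 * (f y)^-1)).
  exact: (ndiffM (ndiffM (@ndiff_cst n (-1)) fn) (ndiffM IH IH)).
by apply: ndiff_ext gn => y Jy; rewrite (derive_in_eq Jy (fV _ Jy)) mulN1r.
Qed.

Lemma ndiff_horner n (P : {poly R[i]}) f : ndiff n f ->
  ndiff n (fun y => P.[f y]).
Proof.
move=> fn; elim/poly_ind: P => [|P c IH].
  by under eq_fun do rewrite horner0; exact: ndiff_cst.
under eq_fun do rewrite hornerMXaddC.
exact: (ndiffD (ndiffM IH fn) (@ndiff_cst n c)).
Qed.

Lemma ndiffX n k f : ndiff n f -> ndiff n (fun y => f y ^+ k).
Proof.
by move=> fn; have := @ndiff_horner n 'X^k f fn; under eq_fun do rewrite hornerXn.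
Qed.

(** The hypotheses matter: where the derivatives of the summands do not exist,
[lim] takes a default value unrelated to the derivative of the sum. *)
Lemma derivenD n f g x : J x -> ndiff n f -> ndiff n g ->
  deriven_in J n (fun y => f y + g y) x = deriven_in J n f x + deriven_in J n g x.
Proof.
move=> Jx; elim: n f g => [//|n IH] f g /ndiffS[f1 fn] /ndiffS[g1 gn].
rewrite !derivenS -IH//; apply: deriven_ext => // y Jy.
by rewrite derive_inD//; [exact: f1|exact: g1].
Qed.

Lemma derivenZ n (c : R[i]) f x : J x -> ndiff n f ->
  deriven_in J n (fun y => c * f y) x = c * deriven_in J n f x.
Proof.
move=> Jx; elim: n f => [//|n IH] f /ndiffS[f1 fn].
rewrite !derivenS -IH//; apply: deriven_ext => // y Jy.
(* the product rule with a constant factor, whose derivative is [0] *)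
rewrite -[RHS]add0r -(mul0r (f y)); apply: derive_in_eq => //.
apply: has_derivativeM; first exact: has_derivative_cst.
exact: derivable_has_derivative (f1 _ Jy).
Qed.

Lemma deriven_sumZ (I : Type) (r : seq I) n (c : I -> R[i])
    (F : I -> R -> R[i]) x : J x -> (forall i, ndiff n (F i)) ->
  deriven_in J n (fun y => \sum_(i <- r) c i * F i y) x =
  \sum_(i <- r) c i * deriven_in J n (F i) x.
Proof.
move=> Jx Fn; have cF i : ndiff n (fun y => c i * F i y).
  exact: (ndiffM (@ndiff_cst n (c i)) (Fn i)).
suff [_ ->] : ndiff n (fun y => \sum_(i <- r) c i * F i y) /\
  deriven_in J n (fun y => \sum_(i <- r) c i * F i y) x =
  \sum_(i <- r) c i * deriven_in J n (F i) x by [].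
elim: r => [|i r [IH1 IH2]].
  under eq_fun do rewrite big_nil; split; first exact: ndiff_cst.
  have -> : (fun=> 0) = (fun=> 0 * 0) :> (R -> R[i]) by rewrite mul0r.
  by rewrite derivenZ ?big_nil ?mul0r //; exact: ndiff_cst.
under eq_fun do rewrite big_cons; split; first exact: (ndiffD (cF i) IH1).
by rewrite (derivenD Jx (cF i) IH1) (derivenZ _ Jx (Fn i)) IH2 big_cons.
Qed.

Lemma leibniz n f g x : J x -> ndiff n f -> ndiff n g ->
  deriven_in J n (fun y => f y * g y) x =
  \sum_(i < n.+1) 'C(n, i)%:R * (deriven_in J i f x * deriven_in J (n - i) g x).
Proof.
move=> Jx; elim: n f g => [|n IH] f g fn1 gn1.
  by rewrite big_ord1 /= bin0 mul1r.
have [/ndiffS[f1 fn] /ndiffS[g1 gn]] := (fn1, gn1).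
have {}fn1 := ndiff_le (leqnSn n) fn1; have {}gn1 := ndiff_le (leqnSn n) gn1.
rewrite derivenS.
rewrite (@deriven_ext n _ (fun y => derive_in J f y * g y + f y * derive_in J g y))//;
  last by move=> y Jy; rewrite derive_inM//; [exact: f1|exact: g1].
rewrite (derivenD Jx (ndiffM fn gn1) (ndiffM fn1 gn)).
rewrite (IH _ _ fn gn1) (IH _ _ fn1 gn) [RHS]big_ord_recl.
(* Pascal's rule; the part in [C(n,i+1)] recombines with the term of index 0 *)
under [X in _ = _ + X]eq_bigr => i _.
  rewrite lift0 binS natrD mulrDl subSS.
over.
rewrite big_split /= addrA [LHS]addrC; congr (_ + _); last first.
  by apply: eq_bigr => i _; rewrite derivenS.
pose a (i : nat) :=
  'C(n, i)%:R * (deriven_in J i f x * deriven_in J (n.+1 - i) g x).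
transitivity (\sum_(i < n.+2) a i).
  rewrite [RHS]big_ord_recr /= [a n.+1]/a bin_small// mul0r addr0.
  by apply: eq_bigr => i _; rewrite /a -derivenS -subSn// -ltnS.
by rewrite big_ord_recl /a !bin0; congr (_ + _); apply: eq_bigr => i _.
Qed.

(** * Vanishing of derivatives at a zero of high order *)

(** A product with [m] factors vanishing at [x] has all its derivatives of order
less than [m] equal to [0] there: in the Leibniz expansion of [h * (h^m g)] the
term with [h] undifferentiated contains [h x = 0], and in the others the second
factor is differentiated at most [k - 1] times. *)
Lemma deriven_vanish m k h g x : J x -> h x = 0 -> (k < m)%N ->
  ndiff k h -> ndiff k g -> deriven_in J k (fun y => h y ^+ m * g y) x = 0.
Proof.
move=> Jx hx0; elim: m k => [//|m IH] k km hk gk.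
have -> : (fun y => h y ^+ m.+1 * g y) = (fun y => h y * (h y ^+ m * g y)).
  by apply/funext => y; rewrite exprS mulrA.
rewrite (leibniz Jx hk (ndiffM (ndiffX (k := m) hk) gk)).
rewrite big1// => -[[|i] /= ik] _; first by rewrite [deriven_in J 0 h x]hx0 mul0r mulr0.
rewrite IH ?mulr0 //; first by lia.
  exact: (ndiff_le (leq_subr _ _) hk).
exact: (ndiff_le (leq_subr _ _) gk).
Qed.

(** The chain rule exhibits the derivative of [P(h)] as a multiple of
[(h - h x)^m], to which [deriven_vanish] applies. *)
Lemma deriven_horner_flat m k (P Q : {poly R[i]}) h x : J x -> (0 < k <= m)%N ->
  P^`() = ('X - (h x)%:P) ^+ m * Q -> ndiff k h ->
  deriven_in J k (fun y => P.[h y]) x = 0.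
Proof.
move=> Jx; case: k => [//|k] km P' hk; have /ndiffS[h1 dhk] := hk.
have {}hk := ndiff_le (leqnSn k) hk.
rewrite derivenS (@deriven_ext k _ (fun y =>
    (h y - h x) ^+ m * (Q.[h y] * derive_in J h y)))//.
- have h0n : ndiff k (fun y => h y - h x) := ndiffD hk (@ndiff_cst k (- h x)).
  have Qn := ndiffM (ndiff_horner (P := Q) hk) dhk.
  by rewrite (deriven_vanish (m := m) Jx _ _ h0n Qn)// subrr.
- move=> y Jy; rewrite mulrA.
  have -> : (h y - h x) ^+ m * Q.[h y] = P^`().[h y] by rewrite P' !hornerE.
  apply: derive_in_eq => //; apply: has_derivative_horner.
  exact: derivable_has_derivative (h1 _ Jy).
Qed.

(** The primitive of [X^(l-1) (1-X)^m] without constant term, that is, the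
incomplete beta integral for [l > 0]; its value at [1] is the beta function at
[(l, m+1)]. *)
Definition beta_poly (l m : nat) : {poly R[i]} :=
  \sum_(p < m.+1) ('C(m, p)%:R * ((-1) ^+ p / (p + l)%:R)) *: 'X^(p + l).

Lemma deriv_beta_poly l m : (0 < l)%N ->
  (beta_poly l m)^`() = ('X - 1%:P) ^+ m * ((-1) ^+ m *: 'X^(l.-1)).
Proof.
move=> l0; have -> : ('X - 1%:P) ^+ m * ((-1) ^+ m *: 'X^(l.-1)) =
    (1 - 'X) ^+ m * 'X^(l.-1) :> {poly R[i]}.
  by rewrite -scalerAr scalerAl -exprZn scaleN1r opprB.
rewrite exprBn mulr_suml raddf_sum; apply: eq_bigr => p _ /=.
rewrite expr1n mulr1 derivZ derivXn -[X in _ *: X]scaler_nat scalerA.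
have pl0 : (p + l)%:R != 0 :> R[i] by rewrite pnatr_eq0; lia.
rewrite -mulrA divfK// -mul_polyC polyCM polyC_natr rmorphXn rmorphN1.
have -> : (p + l).-1 = (p + l.-1)%N by lia.
by rewrite -[X in _ = X * _]mulr_natl exprD !mulrA.
Qed.

(** The left-hand side is [D^m (B(h) w) x] with
[B = beta_poly l m] and [h = g / g x], and [B(h)] is constant to order [m] at
[x] because [B'] has a zero of order [m] at [h x = 1]. *)
Lemma sum_deriven_scaled_power m l g w x : (0 < l)%N -> J x -> g x != 0 ->
  ndiff m g -> ndiff m w ->
  \sum_(p < m.+1) 'C(m, p)%:R * ((-1) ^+ p / (p + l)%:R) * g x ^- (p + l) *
    deriven_in J m (fun y => g y ^+ (p + l) * w y) x =
  \sum_(p < m.+1) 'C(m, p)%:R * ((-1) ^+ p / (p + l)%:R) * deriven_in J m w x.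
Proof.
move=> l0 Jx gx0 gm wm; pose h y := (g x)^-1 * g y.
have hm : ndiff m h := ndiffM (@ndiff_cst m (g x)^-1) gm.
have hx1 : h x = 1 by rewrite /h mulVf.
transitivity (deriven_in J m (fun y => (beta_poly l m).[h y] * w y) x).
  have -> : (fun y => (beta_poly l m).[h y] * w y) = (fun y =>
      \sum_(p < m.+1) ('C(m, p)%:R * ((-1) ^+ p / (p + l)%:R) * g x ^- (p + l)) *
        (g y ^+ (p + l) * w y)).
    apply/funext => y; rewrite /beta_poly horner_sum mulr_suml.
    apply: eq_bigr => p _; rewrite hornerZ hornerXn /h exprMn exprVn.
    by rewrite !mulrA.
  by rewrite (deriven_sumZ _ _ Jx) => [|p]; [|exact: (ndiffM (ndiffX (k := p + l) gm) wm)].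
have Pm := ndiff_horner (P := beta_poly l m) hm.
rewrite (leibniz Jx Pm wm) big_ord_recl big1 => [|i _].
  rewrite addr0 bin0 mul1r subn0 [X in X * _]/deriven_in /= hx1 /beta_poly horner_sum mulr_suml.
  by apply: eq_bigr => p _; rewrite hornerZ hornerXn expr1n mulr1.
have im : (i < m)%N by [].
have hi := ndiff_le im hm.
have P' : (beta_poly l m)^`() = ('X - (h x)%:P) ^+ m * ((-1) ^+ m *: 'X^(l.-1)).
  by rewrite hx1 deriv_beta_poly.
by rewrite (deriven_horner_flat Jx _ P' hi)// mul0r mulr0.
Qed.

(** * Expansion along the derivatives of the outer factor *)

Lemma sum_ord_trunc m n (F : nat -> R[i]) : (m <= n)%N ->
  (forall i, (m <= i < n)%N -> F i = 0) -> \sum_(i < n) F i = \sum_(i < m) F i.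
Proof.
move=> mn F0; rewrite (big_ord_widen n F mn) [RHS]big_mkcond /=.
by apply: eq_bigr => i _; case: ltnP => // mi; rewrite F0 ?mi /=.
Qed.

(** The inner sum depends on [G] through derivatives of the single order [n - j],
taken at [x]; this reduces the identities to one statement per order. *)
Lemma sum_leibniz_outer n (c : nat -> R[i]) (G : nat -> R -> R[i]) v x : J x ->
  ndiff n v -> (forall p, (p <= n)%N -> ndiff n (G p)) ->
  \sum_(p < n.+1) 'C(n, p)%:R * c p *
    deriven_in J (n - p) (fun y => v y * deriven_in J p (G p) y) x =
  \sum_(j < n.+1) 'C(n, j)%:R * deriven_in J j v x *
    \sum_(p < (n - j).+1) 'C(n - j, p)%:R * c p * deriven_in J (n - j) (G p) x.
Proof.
move=> Jx vn Gn.
pose a p j := ('C(n, p) * 'C(n - p, j))%:R * c p *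
  (deriven_in J j v x * deriven_in J (n - j) (G p) x).
transitivity (\sum_(p < n.+1) \sum_(j < n.+1) a p j).
  apply: eq_bigr => p _; have pn : (p <= n)%N by rewrite -ltnS.
  rewrite (leibniz Jx (ndiff_le (leq_subr _ _) vn) (ndiff_deriven pn (Gn _ pn))).
  rewrite (@sum_ord_trunc (n - p).+1) ?ltnS ?leq_subr// => [|j jp]; last first.
    by rewrite /a (@bin_small (n - p)) ?muln0 ?mul0r//; case/andP: jp.
  rewrite mulr_sumr; apply: eq_bigr => j _; rewrite /a natrM.
  rewrite [deriven_in J _ (deriven_in J p _)]/deriven_in -iterD -/(deriven_in _ _ _).
  by have -> : (n - p - j + p = n - j)%N; [have := ltn_ord j; lia|ring].
rewrite exchange_big; apply: eq_bigr => j _; have jn : (j <= n)%N by rewrite -ltnS.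
rewrite (@sum_ord_trunc (n - j).+1 _ (fun p => a p j)) ?ltnS ?leq_subr// => [|p jp].
  rewrite mulr_sumr; apply: eq_bigr => p _; rewrite /a.
  have pj : (p + j <= n)%N by have := ltn_ord p; lia.
  have -> : ('C(n, p) * 'C(n - p, j) = 'C(n, j) * 'C(n - j, p))%N.
    exact: mul_bin_swap.
  by rewrite natrM; ring.
by rewrite /a (@bin_small (n - p)) ?muln0 ?mul0r//; lia.
Qed.

(** The image of [sum_leibniz_outer] under the reversal [p -> n - p]; reversing
the inner sum as well, [q -> n - j - q], produces the shift of the index of [c]
and [G] by [j]. *)
Lemma sum_leibniz_inner n (c : nat -> R[i]) (G : nat -> R -> R[i]) v x : J x ->
  ndiff n v -> (forall p, (p <= n)%N -> ndiff n (G p)) ->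
  \sum_(p < n.+1) 'C(n, p)%:R * c p *
    deriven_in J p (fun y => v y * deriven_in J (n - p) (G p) y) x =
  \sum_(j < n.+1) 'C(n, j)%:R * deriven_in J j v x *
    \sum_(q < (n - j).+1)
      'C(n - j, q)%:R * c (q + j)%N * deriven_in J (n - j) (G (q + j)%N) x.
Proof.
move=> Jx vn Gn.
have G'n p : (p <= n)%N -> ndiff n (G (n - p)%N).
  by move=> _; exact: Gn (leq_subr _ _).
have := @sum_leibniz_outer n (fun p => c (n - p)%N) (fun p => G (n - p)%N) v x Jx vn G'n.
move=> sumE; rewrite (reindex_inj rev_ord_inj) /=.
transitivity (\sum_(p < n.+1) 'C(n, p)%:R * c (n - p)%N *
    deriven_in J (n - p) (fun y => v y * deriven_in J p (G (n - p)%N) y) x).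
  apply: eq_bigr => p _; have pn : (p <= n)%N by rewrite -ltnS.
  by rewrite subSS bin_sub// subKn.
rewrite {}sumE.
apply: eq_bigr => j _; congr (_ * _); have jn : (j <= n)%N by rewrite -ltnS.
rewrite (reindex_inj rev_ord_inj) /=; apply: eq_bigr => q _.
have qj : (q <= n - j)%N by rewrite -ltnS.
rewrite subSS bin_sub//.
by have -> : (n - (n - j - q) = q + j)%N by lia.
Qed.

(** * The two identities *)

Lemma sum_deriven_power_conj n l u v w x : (0 < l)%N -> J x -> u x != 0 ->
  ndiff n u -> ndiff n v -> ndiff n w ->
  \sum_(p < n.+1) 'C(n, p)%:R * ((-1) ^+ p / (p + l)%:R) * u x ^- (p + l) *
    deriven_in J (n - p)
      (fun y => v y * deriven_in J p (fun z => u z ^+ (p + l) * w z) y) x =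
  \sum_(p < n.+1) 'C(n, p)%:R * ((-1) ^+ p / (p + l)%:R) *
    deriven_in J (n - p) (fun y => v y * deriven_in J p w y) x.
Proof.
move=> l0 Jx ux0 un vn wn.
pose c p : R[i] := (-1) ^+ p / (p + l)%:R.
pose G p z := u z ^+ (p + l) * w z.
have Gn p : (p <= n)%N -> ndiff n (G p).
  by move=> _; exact: (ndiffM (ndiffX (k := p + l) un) wn).
have lhsE := sum_leibniz_outer (fun p => c p * u x ^- (p + l)) Jx vn Gn.
have rhsE := sum_leibniz_outer c Jx vn (fun p _ => wn).
under eq_bigr do rewrite -[_ * _ * u x ^- _]mulrA.
rewrite {}lhsE {}rhsE; apply: eq_bigr => j _; congr (_ * _).
under eq_bigr do rewrite mulrA.
exact: (sum_deriven_scaled_power l0 Jx ux0 (ndiff_le (leq_subr j n) un)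
  (ndiff_le (leq_subr j n) wn)).
Qed.

(** The coefficient of [D^j v x] involves [u^-(q+j+l) w], a power of [1/u] with
exponent [q + (j + l)], and the sign [(-1)^j] factors out. *)
Lemma sum_deriven_inv_power_conj n l u v w x : (0 < l)%N -> J x ->
  (forall y, J y -> u y != 0) -> ndiff n u -> ndiff n v -> ndiff n w ->
  \sum_(p < n.+1) 'C(n, p)%:R * ((-1) ^+ p / (p + l)%:R) * u x ^+ (p + l) *
    deriven_in J p
      (fun y => v y * deriven_in J (n - p) (fun z => u z ^- (p + l) * w z) y) x =
  \sum_(p < n.+1) 'C(n, p)%:R * ((-1) ^+ p / (p + l)%:R) *
    deriven_in J p (fun y => v y * deriven_in J (n - p) w y) x.
Proof.
move=> l0 Jx u0 un vn wn; have uVn := ndiffV u0 un.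
pose c p : R[i] := (-1) ^+ p / (p + l)%:R.
pose G p z := u z ^- (p + l) * w z.
have GE p : G p = (fun z => (u z)^-1 ^+ (p + l) * w z).
  by apply/funext => z; rewrite exprVn.
have Gn p : (p <= n)%N -> ndiff n (G p).
  by move=> _; rewrite GE; exact: (ndiffM (ndiffX (k := p + l) uVn) wn).
have lhsE := sum_leibniz_inner (fun p => c p * u x ^+ (p + l)) Jx vn Gn.
have rhsE := sum_leibniz_inner c Jx vn (fun p _ => wn).
under eq_bigr do rewrite -[_ * _ * u x ^+ _]mulrA.
rewrite {}lhsE {}rhsE; apply: eq_bigr => j _; congr (_ * _).
have jl0 : (0 < j + l)%N by rewrite addn_gt0 l0 orbT.
have uVx0 : (u x)^-1 != 0 by rewrite invr_eq0 u0.
have := sum_deriven_scaled_power jl0 Jx uVx0 (ndiff_le (leq_subr j n) uVn)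
  (ndiff_le (leq_subr j n) wn).
move=> /(congr1 ( *%R ((-1) ^+ j))); rewrite !mulr_sumr => powE.
transitivity (\sum_(q < (n - j).+1) (-1) ^+ j *
    ('C(n - j, q)%:R * ((-1) ^+ q / (q + (j + l))%:R) * (u x)^-1 ^- (q + (j + l)) *
      deriven_in J (n - j) (fun y => (u y)^-1 ^+ (q + (j + l)) * w y) x)).
  apply: eq_bigr => q _; rewrite GE /c -!addnA exprD exprVn invrK.
  by rewrite !mulrA; congr (_ * _); ring.
rewrite powE; apply: eq_bigr => q _; rewrite /c -!addnA exprD.
by rewrite !mulrA; congr (_ * _); ring.
Qed.

End DerivativeCalculus.

Theorem proposition2p2 (R : realType) (n : nat) (J : set R)
    (J_itv : is_interval J) (J_nontriv : exists a b : R, [/\ J a, J b & a != b])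
    (l : nat) (l_ge1 : (1 <= l)%N) (u v w : R -> R[i])
    (u_Cn : class_C J n u) (v_Cn : class_C J n v) (w_Cn : class_C J n w)
    (u_neq0 : forall x : R, J x -> u x != 0) :
  (forall x : R, J x ->
     \sum_(0 <= p < n.+1)
        'C(n, p)%:R * ((-1) ^+ p / (p + l)%:R) * u x ^- (p + l) *
        deriven_in J (n - p)
          (fun y => v y * deriven_in J p (fun z => u z ^+ (p + l) * w z) y) x
     = \sum_(0 <= p < n.+1)
        'C(n, p)%:R * ((-1) ^+ p / (p + l)%:R) *
        deriven_in J (n - p) (fun y => v y * deriven_in J p w y) x)
  /\
  (forall x : R, J x ->
     \sum_(0 <= p < n.+1)
        'C(n, p)%:R * ((-1) ^+ p / (p + l)%:R) * u x ^+ (p + l) *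
        deriven_in J p
          (fun y => v y * deriven_in J (n - p) (fun z => u z ^- (p + l) * w z) y) x
     = \sum_(0 <= p < n.+1)
        'C(n, p)%:R * ((-1) ^+ p / (p + l)%:R) *
        deriven_in J p (fun y => v y * deriven_in J (n - p) w y) x).
Proof.
have ndiff_class_C f : class_C J n f -> ndiff J n f by case.
have un := ndiff_class_C _ u_Cn; have vn := ndiff_class_C _ v_Cn.
have wn := ndiff_class_C _ w_Cn.
split=> x Jx; rewrite !big_mkord.
- exact: (sum_deriven_power_conj J_itv J_nontriv l_ge1 Jx (u_neq0 x Jx) un vn wn).
- exact: (sum_deriven_inv_power_conj J_itv J_nontriv l_ge1 Jx u_neq0 un vn wn).
Qed.
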